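(* Let $\alpha\in(0,1]$ and let $V:\mathbb{R}^n\to\mathbb{R}$ be defined by $$V(x):=\sup_{\pi\in\Pi}\ \sup_{l\in\mathbb{N}}\ \max_{j\in\{1,\dots,n_0\}}\alpha^l\,h'_{0,j}\big(\phi^{\pi}_{x}(l)\big).$$ Then $\mathcal{R}_0=\{x\in\mathbb{R}^n\mid V(x)\le 0\}$. Moreover, if $\alpha\in(0,1)$, then $V(x)\ge 0$ for all $x\in\mathbb{R}^n$, and consequently $\mathcal{R}_0=\{x\in\mathbb{R}^n\mid V(x)=0\}$.
   Context: Here $\mathbb{N}=\{0,1,2,\dots\}$. Fix integers $n,m,k\ge 1$. Let $h_{0,1},\dots,h_{0,n_0}\in\mathbb{R}[x]$ ($x\in\mathbb{R}^n$) and let $X_0=\{x\in\mathbb{R}^n\mid h_{0,j}(x)\le 0,\ j=1,\dots,n_0\}$, assumed compact. Let $X_1,\dots,X_k\subseteq\mathbb{R}^n$ be pairwise disjoint sets with $\bigcup_{i=1}^k X_i=\mathbb{R}^n$, each of the form $X_i=\{x\mid h_{i,j}(x)\rhd 0,\ j=1,\dots,n_i\}$ with polynomials $h_{i,j}$ and $\rhd\in\{\le,<\}$. Let $D=\{d\in\mathbb{R}^m\mid h_{k+1,l}(d)\le 0,\ l=1,\dots,n_{k+1}\}$ with polynomials $h_{k+1,l}$. Let $f_1,\dots,f_k:\mathbb{R}^n\times\mathbb{R}^m\to\mathbb{R}^n$ be polynomial maps and define $f(x,d)=f_i(x,d)$ whenever $x\in X_i$. An input policy is a sequence $\pi=(d(l))_{l\in\mathbb{N}}$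 with $d(l)\in D$ for all $l$; $\Pi$ denotes the set of all input policies. For $x\in\mathbb{R}^n$ and $\pi\in\Pi$, the trajectory $\phi^\pi_x:\mathbb{N}\to\mathbb{R}^n$ is defined by $\phi^\pi_x(0)=x$ and $\phi^\pi_x(l+1)=f(\phi^\pi_x(l),d(l))$. The maximal robust invariant set is $\mathcal{R}_0=\{x\in\mathbb{R}^n\mid \phi^\pi_x(l)\in X_0\ \forall l\in\mathbb{N},\ \forall\pi\in\Pi\}$. For $j=1,\dots,n_0$, $h'_{0,j}(x):=\dfrac{h_{0,j}(x)}{1+h_{0,j}(x)^2}$. *)

(* Defs.v *)
(* mpoly is only Required, not Imported: its notations clash with those of
   MathComp-Analysis. *)
From mathcomp Require Export all_boot all_order all_algebra.
From mathcomp Require Export boolp classical_sets reals topology normedtype.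
From mathcomp Require mpoly.
Export Order.TTheory GRing.Theory Num.Theory.
Export numFieldNormedType.Exports.

Set Implicit Arguments.
Unset Strict Implicit.
Unset Printing Implicit Defensive.

Global Open Scope classical_set_scope.
Global Open Scope ring_scope.

Definition poly_at (R : realType) (n : nat) (p : mpoly.mpoly n R)
    (x : 'rV[R]_n) : R :=
  mpoly.meval (fun i => x ord0 i) p.

Definition sublevel_set (R : realType) (n r : nat)
    (h : 'I_r -> mpoly.mpoly n R) : set 'rV[R]_n :=
  [set x | forall j, poly_at (h j) x <= 0].

(* The relation is chosen constraint by constraint: the j-th one is
   h_j(x) <= 0 if large j = true, and h_j(x) < 0 if large j = false. *)
Definition mixed_set (R : realType) (n r : nat)
    (h : 'I_r -> mpoly.mpoly n R) (large : 'I_r -> bool) : set 'rV[R]_n :=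
  [set x | forall j, poly_at (h j) x < 0 ?<= if large j].

(* A polynomial map R^n x R^m -> R^n: its i-th component is a polynomial in
   the n + m variables (x_1, ..., x_n, d_1, ..., d_m). *)
Definition poly_map_at (R : realType) (n m : nat)
    (g : 'I_n -> mpoly.mpoly (n + m) R) (x : 'rV[R]_n) (d : 'rV[R]_m) :
    'rV[R]_n :=
  \row_i poly_at (g i) (row_mx x d).

Definition input_policies (R : realType) (m : nat) (D : set 'rV[R]_m) :
    set (nat -> 'rV[R]_m) :=
  [set pi | forall l, D (pi l)].

Fixpoint trajectory (R : realType) (n m : nat)
    (f : 'rV[R]_n -> 'rV[R]_m -> 'rV[R]_n) (x : 'rV[R]_n)
    (pi : nat -> 'rV[R]_m) (l : nat) : 'rV[R]_n :=
  if l is l'.+1 then f (trajectory f x pi l') (pi l') else x.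

Definition max_robust_invariant (R : realType) (n m : nat)
    (f : 'rV[R]_n -> 'rV[R]_m -> 'rV[R]_n) (X0 : set 'rV[R]_n)
    (D : set 'rV[R]_m) : set 'rV[R]_n :=
  [set x | forall l pi, input_policies D pi -> X0 (trajectory f x pi l)].

Definition normalized_at (R : realType) (n : nat) (p : mpoly.mpoly n R)
    (x : 'rV[R]_n) : R :=
  poly_at p x / (1 + poly_at p x ^+ 2).

Definition max_ord (R : realType) (r : nat) (F : 'I_r.+1 -> R) : R :=
  \big[Num.max/F ord0]_(j < r.+1) F j.

(* Every real number `normalized_at p y` has absolute value at most 1/2, so for
   0 < alpha <= 1 both suprema are taken over bounded sets.  The inner one is
   over a nonempty set, and the outer one too as soon as D is nonempty; when D
   is empty, `sup set0 = 0` makes the function identically 0. *)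
Definition value_function (R : realType) (n m r : nat)
    (f : 'rV[R]_n -> 'rV[R]_m -> 'rV[R]_n)
    (h0 : 'I_r.+1 -> mpoly.mpoly n R) (D : set 'rV[R]_m) (alpha : R)
    (x : 'rV[R]_n) : R :=
  sup [set sup [set max_ord (fun j =>
                      alpha ^+ l * normalized_at (h0 j) (trajectory f x pi l))
               | l in [set: nat]]
      | pi in input_policies D].

(* Main.v *)
(** The map t |-> t / (1 + t^2) preserves the sign and is bounded by 1 in
    absolute value, and multiplying by alpha^l > 0 preserves the sign as well.
    So V x is a supremum of bounded sets of reals, and it is nonpositive exactly
    when every h_{0,j} is nonpositive along every trajectory from x.  If
    alpha < 1, the discounted values along any trajectory are at least -alpha^l,
    which tends to 0, so their supremum is nonnegative. *)
Require Import Defs.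
From mathcomp Require Import sequences.
From mathcomp Require Import lra.

Section Sup.
Variable R : realType.
Implicit Type A : set R.

(* This covers A = set0, where sup A = 0. *)
Lemma sup_le0P A : has_ubound A -> (sup A <= 0 <-> ubound A 0).
Proof.
move=> ubA; split=> [supA a Aa | A0].
  exact: le_trans (ub_le_sup ubA Aa) supA.
have [->|/set0P neA] := eqVneq A set0; first by rewrite sup0.
exact: ge_sup.
Qed.

Lemma sup_le1 A : ubound A 1 -> sup A <= 1.
Proof.
move=> A1; have [->|/set0P neA] := eqVneq A set0; first by rewrite sup0 ler01.
exact: ge_sup.
Qed.

(** The second hypothesis also forces [A] to be nonempty, so the default value of [sup] never arises
    here. *)
Lemma sup_ge0 A : has_ubound A ->
  (forall e, 0 < e -> exists2 a, A a & - e <= a) -> 0 <= sup A.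
Proof.
move=> ubA approx; rewrite leNgt; apply/negP => supA.
(* Half the gap to 0: the resulting element is at least [sup A / 2], which exceeds a negative
   [sup A]. *)
have [|a Aa] := approx (- sup A / 2); first by lra.
by have := ub_le_sup ubA Aa; lra.
Qed.

End Sup.

Section MaxOrd.
Variables (R : realType) (r : nat).
Implicit Type F : 'I_r.+1 -> R.

Lemma max_ord_leP F c : max_ord F <= c <-> forall j, F j <= c.
Proof.
by split=> [/bigmax_leP[_ Fc] j|Fc]; [exact: Fc | exact: bigmax_le].
Qed.

Lemma le_max_ord F j : F j <= max_ord F.
Proof. exact: le_bigmax. Qed.

End MaxOrd.

Section Normalized.
Variables (R : realType) (n : nat) (p : mpoly.mpoly n R).
Implicit Type x : 'rV[R]_n.

Lemma normalized_at_le0 x : (normalized_at p x <= 0) = (poly_at p x <= 0).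
Proof. by rewrite ler_pdivrMr ?mul0r// ltr_pwDl// sqr_ge0. Qed.

Lemma normalized_at_norm_le1 x : `|normalized_at p x| <= 1.
Proof.
have d0 : 0 < 1 + poly_at p x ^+ 2 by rewrite ltr_pwDl// sqr_ge0.
rewrite ler_norml ler_pdivrMr// ler_pdivlMr//.
(* With t the value of [p] at [x], this is -(1 + t^2) <= t <= 1 + t^2, true because t^2 + t + 1 and
   t^2 - t + 1 are positive. *)
by apply/andP; split; nra.
Qed.

Lemma discounted_norm_le (alpha : R) l x :
  0 <= alpha -> `|alpha ^+ l * normalized_at p x| <= alpha ^+ l.
Proof.
move=> a0; rewrite normrM ger0_norm ?exprn_ge0//.
by rewrite ler_piMr ?exprn_ge0// normalized_at_norm_le1.
Qed.

End Normalized.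

Section ValueFunction.
Variables (R : realType) (n m r : nat).
Variables (f : 'rV[R]_n -> 'rV[R]_m -> 'rV[R]_n).
Variables (h0 : 'I_r.+1 -> mpoly.mpoly n R) (D : set 'rV[R]_m) (alpha : R).
Hypothesis alpha01 : 0 < alpha <= 1.

Let a0 : 0 < alpha. Proof. by case/andP: alpha01. Qed.

Let stage x pi l : R := max_ord (fun j =>
  alpha ^+ l * normalized_at (h0 j) (trajectory f x pi l)).

Let value x pi : R := sup [set stage x pi l | l in [set: nat]].

Lemma stage_le1 x pi : ubound [set stage x pi l | l in [set: nat]] 1.
Proof.
move=> _ [l _ <-]; apply/max_ord_leP => j.
apply: le_trans (ler_norm _) _.
apply: le_trans (discounted_norm_le _ _ _ _ _ _ (ltW a0)) _.
by case/andP: alpha01 => _ a1; rewrite exprn_ile1// ltW.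
Qed.

(** The maximum dominates its entry at [ord0], and a single entry is enough for a lower bound. *)
Lemma stage_geN x pi l : - alpha ^+ l <= stage x pi l.
Proof.
apply: le_trans (le_max_ord _ _ _ ord0).
by have := discounted_norm_le _ _ (h0 ord0) _ l (trajectory f x pi l) (ltW a0);
  rewrite ler_norml => /andP[].
Qed.

Lemma stage_le0P x pi l :
  stage x pi l <= 0 <-> sublevel_set h0 (trajectory f x pi l).
Proof.
split=> [/max_ord_leP s0 j | s0]; last apply/max_ord_leP => j.
  by have := s0 j; rewrite pmulr_rle0 ?exprn_gt0// normalized_at_le0.
by rewrite pmulr_rle0 ?exprn_gt0// normalized_at_le0; apply: s0.
Qed.

Lemma has_ubound_value x : has_ubound [set value x pi | pi in input_policies D].
Proof. by exists 1 => _ [pi _ <-]; apply/sup_le1/stage_le1. Qed.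

Lemma value_le0P x pi :
  value x pi <= 0 <-> forall l, sublevel_set h0 (trajectory f x pi l).
Proof.
have ubS : has_ubound [set stage x pi l | l in [set: nat]].
  by exists 1; apply: stage_le1.
split=> [/(sup_le0P _ _ ubS) s0 l | s0].
  by apply/stage_le0P/s0; exists l.
by apply/(sup_le0P _ _ ubS) => _ [l _ <-]; apply/stage_le0P.
Qed.

(** Nonpositivity passes through the two nested suprema by applying [sup_le0P] to each. If there is
    no policy, both sides hold: the supremum is 0 and invariance is vacuous. *)
Lemma value_function_le0P x :
  value_function f h0 D alpha x <= 0 <->
  max_robust_invariant f (sublevel_set h0) D x.
Proof.
split=> [/(sup_le0P _ _ (has_ubound_value x)) v0 l pi Dpi | inv].
  by move: l; apply/value_le0P/v0; exists pi.
apply/(sup_le0P _ _ (has_ubound_value x)) => _ [pi Dpi <-].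
by apply/value_le0P => l; apply: inv.
Qed.

Lemma value_ge0 x pi : alpha < 1 -> 0 <= value x pi.
Proof.
move=> a1; apply: sup_ge0 => [|e e0]; first by exists 1; apply: stage_le1.
have cvg_alpha : alpha ^+ l @[l --> \oo] --> (0 : R).
  by apply: cvg_expr; rewrite gtr0_norm.
(* The threshold beyond which [alpha ^+ l] stays below [e] serves itself as the stage [l]. *)
have [l _ /(_ l (leqnn l))/= small] := cvgr0_norm_lt _ cvg_alpha _ e0.
exists (stage x pi l); first by exists l.
apply: le_trans (stage_geN x pi l); rewrite lerN2 ltW//.
by rewrite ger0_norm ?exprn_ge0 ?ltW in small.
Qed.

Lemma value_function_ge0 x : alpha < 1 -> 0 <= value_function f h0 D alpha x.
Proof.
(* Without policies the outer supremum is the default 0; otherwise any one policy bounds it from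
   below. *)
move=> a1; have [D0|/set0P[pi Dpi]] := eqVneq (input_policies D) set0.
  by rewrite /value_function D0 image_set0 sup0.
apply: (le_trans (value_ge0 x pi a1)).
by apply: (ub_le_sup (has_ubound_value x)); exists pi.
Qed.

End ValueFunction.

(* r.+1 is the (positive) number n_0 of polynomials defining X_0;
   nX i is n_i and nD is n_{k+1}. *)
Theorem theorem1 (R : realType) (n m k r nD : nat) (nX : 'I_k -> nat)
    (h0 : 'I_r.+1 -> mpoly.mpoly n R)
    (hX : forall i : 'I_k, 'I_(nX i) -> mpoly.mpoly n R)
    (large : forall i : 'I_k, 'I_(nX i) -> bool)
    (hD : 'I_nD -> mpoly.mpoly m R)
    (fs : 'I_k -> 'I_n -> mpoly.mpoly (n + m) R)
    (f : 'rV[R]_n -> 'rV[R]_m -> 'rV[R]_n)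
    (alpha : R) :
  let X0 := sublevel_set h0 in
  let X := fun i : 'I_k => mixed_set (hX i) (large i) in
  let D := sublevel_set hD in
  let R0 := max_robust_invariant f X0 D in
  let V := value_function f h0 D alpha in
  (1 <= n)%N -> (1 <= m)%N -> (1 <= k)%N ->
  compact X0 ->
  trivIset [set: 'I_k] X ->
  \bigcup_(i in [set: 'I_k]) X i = [set: 'rV[R]_n] ->
  (forall (i : 'I_k) (x : 'rV[R]_n) (d : 'rV[R]_m),
     X i x -> f x d = poly_map_at (fs i) x d) ->
  0 < alpha <= 1 ->
  R0 = [set x | V x <= 0] /\
  (alpha < 1 ->
     (forall x, 0 <= V x) /\ R0 = [set x | V x = 0]).
Proof.
move=> X0 X D R0 V _ _ _ _ _ _ _ alpha01.
have R0E : R0 = [set x | V x <= 0].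
  by apply/seteqP; split=> x /= /(value_function_le0P _ _ _ _ f h0 D _ alpha01).
split=> // a1.
have V0 x : 0 <= V x by apply: value_function_ge0.
split=> //; rewrite R0E; apply/seteqP; split=> x /= => [Vx|->//].
by apply/eqP; rewrite eq_le Vx V0.
Qed.
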